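(* Let $\mathcal{P}$ be a $d$-dimensional integral polytope with Ehrhart polynomial $i(\mathcal{P},t)=1+\sum_{i=1}^{d}c_it^i$, where each $c_i\neq0$. Then there exists a $(d+3)$-dimensional integral polytope $\mathcal{Q}$ with Ehrhart polynomial $i(\mathcal{Q},t)=1+\sum_{i=1}^{d+3}h_it^i$ such that $\mathrm{sgn}(h_i)=\mathrm{sgn}(c_{i-3})$ for all $4\le i\le d+1$, $\mathrm{sgn}(h_3)=+1$, $\mathrm{sgn}(h_2)=-\mathrm{sgn}(c_1)$, and $\mathrm{sgn}(h_1)=-1$.
   Context: An integral polytope is a convex polytope all of whose vertices have integer coordinates. For an integral polytope $\mathcal{P}\subseteq\mathbb{R}^N$ of dimension $d$, $i(\mathcal{P},t)=|t\mathcal{P}\cap\mathbb{Z}^N|$ ($t$ a positive integer) is a polynomial in $t$ of degree $d$ with constant term $1$, the Ehrhart polynomial. $\mathrm{sgn}(x)\in\{-1,0,+1\}$ denotes the sign of a real number $x$, with $\mathrm{sgn}(0)=0$. Throughout, dimensions $d$ are assumed to satisfy $d\ge3$. *)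

(* Defs.v *)
From HB Require Import structures.
From mathcomp Require Import all_boot all_order all_algebra.
From mathcomp Require Import finmap.
From mathcomp Require Import all_classical all_reals.
From mathcomp Require Import convex.

Set Implicit Arguments.
Unset Strict Implicit.
Unset Printing Implicit Defensive.

Import Order.TTheory GRing.Theory Num.Theory.

Local Open Scope classical_set_scope.
Local Open Scope ring_scope.

Section Polytopes.
Variables (R : realType) (N : nat).
Implicit Types (P : set 'rV[R]_N) (d t : nat) (p : {poly R}).

Definition convex_hull P : set 'rV[R]_N :=
  smallest (fun A : set 'rV[R]_N => convex_set A) P.

Definition is_polytope P : Prop :=
  exists2 S : set 'rV[R]_N, finite_set S & P = convex_hull S.

(* Vertices are the extreme points; for a polytope these are exactly its
   0-dimensional faces. *)
Definition is_vertex P (v : 'rV[R]_N) : Prop :=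
  P v /\ forall (x y : 'rV[R]_N) (a : R), P x -> P y -> 0 < a < 1 ->
    v = a *: x + (1 - a) *: y -> x = v /\ y = v.

Definition integer_points : set 'rV[R]_N := [set x | x \is a mxOver Num.int].

Definition integral_polytope P : Prop :=
  is_polytope P /\ forall v, is_vertex P v -> integer_points v.

Definition affine_set P : Prop :=
  forall (x y : 'rV[R]_N) (a : R), P x -> P y -> P (a *: x + (1 - a) *: y).

Definition affine_hull P : set 'rV[R]_N := smallest affine_set P.

(* [P] has dimension [d] when its affine hull is a translate of a
   [d]-dimensional linear subspace; the empty set has no dimension. *)
Definition has_dimension P d : Prop :=
  exists (x0 : 'rV[R]_N) (V : {vspace 'rV[R]_N}),
    \dim V = d /\ affine_hull P = [set x0 + v | v in [set` V]].

Definition dilate t P : set 'rV[R]_N := [set t%:R *: x | x in P].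

(* [fset_set] returns the empty finite set on infinite sets, but a polytope is
   bounded, so each of its dilates contains finitely many integer points. *)
Definition ehrhart P t : nat := #|` fset_set (dilate t P `&` integer_points)|.

Definition is_ehrhart_polynomial P p : Prop :=
  forall t, (0 < t)%N -> (ehrhart P t)%:R = p.[t%:R].

End Polytopes.

(* Main.v *)
Require Import Defs.
From mathcomp Require Import all_boot all_order all_algebra.
From mathcomp Require Import finmap.
From mathcomp Require Import all_classical all_reals.
From mathcomp Require Import interval_inference convex.
From mathcomp Require Import ring lra zify.

(** Take [Q = P x T], where [T] is the [k]-th dilate of Reeve's tetrahedron
    conv {0, e1, e2, e1 + e2 + m e3}, which has Ehrhart polynomial
    1 + k (2 - m/6) t + k^2 t^2 + k^3 (m/6) t^3.  Ehrhart polynomials multiply,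
    so h_i = a3 c_(i-3) + a2 c_(i-2) + a1 c_(i-1) + c_i with c_0 = 1.
    For m = 6 (k^2 + 4) this gives a3 ~ k^5, a1 ~ - k^3 and a2 = k^2, so for
    large [k] the sign of h_i is that of a3 c_(i-3) when i >= 3, of a1 c_1 when
    i = 2, and of a1 when i = 1. *)

Set Implicit Arguments.
Unset Strict Implicit.
Unset Printing Implicit Defensive.

Import Order.TTheory GRing.Theory Num.Theory.

(** * Counting lattice points in dilated simplices and in Reeve's tetrahedron *)

Section LatticePointCounts.
Local Open Scope nat_scope.

(** Each entry of such a triple is at most [n], so the triples are the 3-tuples over ['I_n.+1] of
    bounded sum, whose number is a known binomial coefficient. *)
Lemma simplex_seq n : exists s : seq (nat * nat * nat),
  [/\ uniq s, forall a b c, ((a, b, c) \in s) = (a + b + c <= n)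
    & size s = 'C(n + 3, 3)].
Proof.
pose f (t : 3.-tuple 'I_n.+1) : nat * nat * nat :=
  (tnth t 0%R : nat, tnth t 1%R : nat, tnth t (2%R : 'I_3) : nat).
pose A := [set t : 3.-tuple 'I_n.+1 | \sum_(i <- t) i <= n].
have sumE (t : 3.-tuple 'I_n.+1) : \sum_(i <- t) i = (f t).1.1 + (f t).1.2 + (f t).2.
  rewrite big_tuple !big_ord_recr big_ord0 /= add0n.
  by congr (_ + _ + _); congr (nat_of_ord (tnth t _)); exact: val_inj.
have f_inj : injective f.
  move=> t u [/val_inj e0 /val_inj e1 /val_inj e2]; apply: eq_from_tnth => i.
  have [->|->|->] : [\/ i = 0%R, i = 1%R | i = (2%R : 'I_3)] => //.
  by case: i => -[|[|[|//]]] ?; [constructor 1|constructor 2|constructor 3]; exact: val_inj.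
exists [seq f t | t <- enum A]; split.
- by rewrite map_inj_uniq// enum_uniq.
- move=> a b c; apply/mapP/idP => [[t]|abc].
    by rewrite mem_enum inE sumE /= => tn e; case: e tn => -> -> ->.
  have fE : (a, b, c) = f [tuple inord a; inord b; inord c].
    by rewrite /f !(tnth_nth ord0) /= !inordK//; lia.
  by exists [tuple inord a; inord b; inord c]; rewrite // mem_enum inE sumE -fE.
- by rewrite size_map -cardE card_partial_ord_partitions addnC.
Qed.

(** For the box points at height 2, which leave only [n - 2] for the coefficients. When [n < 2] that
    subtraction truncates, but there are no triples and the binomial is 0. *)
Lemma simplex2_seq n : exists s : seq (nat * nat * nat),
  [/\ uniq s, forall a b c, ((a, b, c) \in s) = (a + b + c + 2 <= n)
    & size s = 'C(n + 1, 3)].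
Proof.
have [n2|n2] := ltnP n 2.
  exists [::]; split=> // [a b c|]; first by rewrite in_nil; lia.
  by rewrite bin_small//; lia.
have [s [us ms ss]] := simplex_seq (n - 2); exists s; split=> //.
  by move=> a b c; rewrite ms; lia.
by rewrite ss; congr binomial; lia.
Qed.

(* The conditions describe the lattice points of the [n]-th dilate of Reeve's
   tetrahedron.  Such a point is uniquely a (e1, e2, (1, 1, m))-combination
   plus a lattice point of the half-open parallelepiped they span: the origin
   (r = 0), or one of the (1, 1, r) with 0 < r < m, which lie at height 2. *)
Lemma reeve_seq m n : 0 < m -> exists s : seq (nat * nat * nat),
  [/\ uniq s,
      forall x y z, ((x, y, z) \in s) =
        [&& z <= m * x, z <= m * y & m * (x + y) <= m * n + z]
    & size s = 'C(n + 3, 3) + m.-1 * 'C(n + 1, 3)].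
Proof.
move=> m0.
have [s0 [us0 ms0 ss0]] := simplex_seq n.
have [s2 [us2 ms2 ss2]] := simplex2_seq n.
(* The point with coefficients [t] and box point [r]; the test [0 < r] adds the (1, 1) of the box
   point (1, 1, r). Its last coordinate modulo [m] gives back [r]. *)
pose g r (t : nat * nat * nat) :=
  (t.1.1 + t.2 + (0 < r), t.1.2 + t.2 + (0 < r), m * t.2 + r).
have g_inj r t r' t' : r < m -> r' < m -> g r t = g r' t' -> (r, t) = (r', t').
  case: t => -[a b] c; case: t' => -[a' b'] c' rm rm' [/= ea eb ec].
  have er : r = r'.
    have := congr1 (modn^~ m) ec; rewrite ![m * _]mulnC !modnMDl.
    by rewrite !modn_small.
  subst r'; have ecc : c = c' by apply/eqP; rewrite -(eqn_pmul2l m0); apply/eqP; lia.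
  by subst c'; congr (_, (_, _, _)); lia.
exists ([seq g 0 t | t <- s0] ++ [seq g r t | r <- iota 1 m.-1, t <- s2]); split.
- rewrite cat_uniq; apply/and3P; split.
  + by rewrite map_inj_in_uniq// => t t' _ _ /(g_inj _ _ _ _ m0 m0)[].
  + apply/hasPn => _ /allpairsP[[r t] /= [+ _ ->]]; rewrite mem_iota => rm.
    have rm' : r < m by lia.
    by apply/mapP => -[t' _ /(g_inj _ _ _ _ rm' m0)[r0 _]]; rewrite r0 in rm.
  + apply: allpairs_uniq; rewrite ?iota_uniq// => -[r t] [r' t'] /=.
    move=> /allpairsP[[? ?] /= [+ _ [-> ->]]] /allpairsP[[? ?] /= [+ _ [-> ->]]].
    by rewrite !mem_iota => ? ? e; apply: g_inj e; lia.
- move=> x y z; rewrite mem_cat; apply/orP/and3P.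
    case=> [/mapP[[[a b] c]]|/allpairsP[[r [[a b] c]] /= [+ +]]].
      by rewrite ms0 => abc [-> -> ->]; split; nia.
    by rewrite ms2 mem_iota => rm abc [-> -> ->]; split; nia.
  move=> [zx zy xyz].
  move: (z %/ m) (z %% m) (divn_eq z m) (ltn_pmod z m0) => q r zE rm.
  (* From m (x + y) <= m n + q m + r with r < m. This bounds the height x + y - q of the
     decomposition by [n]. *)
  have xyq : x + y < n + q + 1 by rewrite -(ltn_pmul2l m0); lia.
  have [r0|r0] := posnP r.
    left; apply/mapP; exists (x - q, y - q, q); first by rewrite ms0; nia.
    by rewrite /g /=; congr (_, _, _); nia.
  (* As r > 0, the bounds z <= m x and z <= m y are strict for q m, so the subtractions of [q.+1]
     below do not truncate. *)
  have qx : q < x by rewrite -(ltn_pmul2l m0); lia.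
  have qy : q < y by rewrite -(ltn_pmul2l m0); lia.
  right; apply/allpairsP; exists (r, (x - q.+1, y - q.+1, q)); split=> /=.
  + by rewrite mem_iota; lia.
  + by rewrite ms2; lia.
  + by rewrite /g /= r0; congr (_, _, _); lia.
- by rewrite size_cat size_map size_allpairs size_iota ss0 ss2.
Qed.

End LatticePointCounts.

Local Open Scope classical_set_scope.
Local Open Scope ring_scope.

(** * Convex and affine hulls of products, treated together *)

Section Hull.
Variables (R : realType) (K : set R).

(* Convexity is the case [K = [0, 1]], affine closure the case [K = setT]. *)
Definition comb_closed N (A : set 'rV[R]_N) : Prop :=
  forall x y a, K a -> A x -> A y -> A (a *: x + (1 - a) *: y).

Definition hull N (A : set 'rV[R]_N) : set 'rV[R]_N := smallest (@comb_closed N) A.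

Definition prod_set M N (A : set 'rV[R]_M) (B : set 'rV[R]_N) : set 'rV[R]_(M + N) :=
  [set z | A (lsubmx z) /\ B (rsubmx z)].

Lemma hull_comb_closed N (A : set 'rV[R]_N) : comb_closed (hull A).
Proof.
move=> x y a Ka hx hy B [cB AB].
by apply: (cB) => //; [exact: (hx B)|exact: (hy B)].
Qed.

Lemma comb_closed_prod M N (A : set 'rV[R]_M) (B : set 'rV[R]_N) :
  comb_closed A -> comb_closed B -> comb_closed (prod_set A B).
Proof.
move=> cA cB x y a Ka [Ax Bx] [Ay By]; split; rewrite linearD !linearZ.
- exact: cA.
- exact: cB.
Qed.

(** For the harder inclusion, fix one component: since v = a v + (1 - a) v, the points whose pairing
    with it lies in the hull of the product form a closed set. Do this first with the left component
    in [A], then with the right one in [hull B]. *)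
Lemma hull_prod M N (A : set 'rV[R]_M) (B : set 'rV[R]_N) :
  hull (prod_set A B) = prod_set (hull A) (hull B).
Proof.
apply/seteqP; split.
  apply: smallest_sub; first by apply: comb_closed_prod; exact: hull_comb_closed.
  by move=> z [Az Bz]; split; apply: sub_gen_smallest.
have comb_row (x x' : 'rV[R]_M) (y y' : 'rV[R]_N) a :
    row_mx (a *: x + (1 - a) *: x') (a *: y + (1 - a) *: y') =
    a *: row_mx x y + (1 - a) *: row_mx x' y'.
  by rewrite !scale_row_mx add_row_mx.
have idem N' (v : 'rV[R]_N') a : v = a *: v + (1 - a) *: v.
  by rewrite -scalerDl addrC subrK scale1r.
have hullB x : A x -> hull B `<=` [set y | hull (prod_set A B) (row_mx x y)].
  move=> Ax; apply: smallest_sub => [y y' a Ka hy hy' /=|y By /=].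
    by rewrite [x in row_mx x _](idem _ x a) comb_row; exact: hull_comb_closed.
  by apply: sub_gen_smallest; rewrite /prod_set /= row_mxKl row_mxKr.
move=> z [Az Bz]; rewrite -[z]hsubmxK.
suff : hull A `<=` [set x | hull (prod_set A B) (row_mx x (rsubmx z))] by exact.
apply: smallest_sub => [x x' a Ka hx hx' /=|x Ax /=]; last exact: hullB.
by rewrite [x in row_mx _ x](idem _ (rsubmx z) a) comb_row; exact: hull_comb_closed.
Qed.

End Hull.

(** * Integrality, dimension and Ehrhart function of a product *)

Section Products.
Variable R : realType.

Definition unit_itv : set R := [set a | 0 <= a <= 1].

Lemma convex_setE N (A : set 'rV[R]_N) : convex_set A <-> comb_closed unit_itv A.
Proof.
split=> cA.
  move=> x y a /andP[a0 a1] Ax Ay.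
  by have := cA x y (Itv01 a0 a1); rewrite !inE; exact.
move=> x y l; rewrite !inE => Ax Ay; apply: cA => //.
by rewrite /unit_itv /=; apply/andP; split; [exact: ge0|exact: le1].
Qed.

Lemma convex_hullE N (A : set 'rV[R]_N) : convex_hull A = hull unit_itv A.
Proof.
by apply/seteqP; split=> x hx B [cB AB]; apply: hx; split=> //; exact/convex_setE.
Qed.

Lemma affine_hullE N (A : set 'rV[R]_N) : affine_hull A = hull setT A.
Proof.
apply/seteqP; split=> x hx B [cB AB]; apply: hx; split=> //.
  by move=> u v a; exact: cB.
by move=> u v a _; exact: cB.
Qed.

Lemma finite_prod_set M N (A : set 'rV[R]_M) (B : set 'rV[R]_N) :
  finite_set A -> finite_set B -> finite_set (prod_set A B).
Proof.
move=> fA fB; apply: (@sub_finite_set _ _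
  [set row_mx p.1 p.2 | p in A `*` B]); last exact/finite_image/finite_setX.
by move=> z [Az Bz]; exists (lsubmx z, rsubmx z) => //=; rewrite hsubmxK.
Qed.

Lemma integer_points_prod M N :
  @integer_points R (M + N) = prod_set (@integer_points R M) (@integer_points R N).
Proof.
apply/seteqP; split=> z.
  by move=> /mxOverP Iz; split; apply/mxOverP => i j; rewrite mxE.
move=> [/mxOverP Iz /mxOverP Jz]; rewrite -[z]hsubmxK.
by apply/mxOverP => i j; case: (split_ordP j) => k ->; rewrite ?row_mxEl ?row_mxEr.
Qed.

(** Both components of a vertex are vertices: a segment through one component lifts to a segment
    through the vertex by keeping the other component fixed. *)
Lemma integral_polytope_prod M N (P : set 'rV[R]_M) (Q : set 'rV[R]_N) :
  integral_polytope P -> integral_polytope Q -> integral_polytope (prod_set P Q).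
Proof.
move=> [[S fS ->] vP] [[T fT ->] vQ]; split.
  exists (prod_set S T); first exact: finite_prod_set.
  by rewrite !convex_hullE hull_prod.
move=> v [[Pv Qv] ext].
have Iv : integer_points (lsubmx v).
  apply: vP; split=> // x y a Px Py a01 e.
  have [] := ext (row_mx x (rsubmx v)) (row_mx y (rsubmx v)) a.
  - by rewrite /prod_set /= row_mxKl row_mxKr.
  - by rewrite /prod_set /= row_mxKl row_mxKr.
  - by [].
  - rewrite !scale_row_mx add_row_mx -e -scalerDl addrC subrK scale1r.
    by rewrite hsubmxK.
  by move=> ex ey; split; [rewrite -ex|rewrite -ey]; rewrite row_mxKl.
have Jv : integer_points (rsubmx v).
  apply: vQ; split=> // x y a Px Py a01 e.
  have [] := ext (row_mx (lsubmx v) x) (row_mx (lsubmx v) y) a.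
  - by rewrite /prod_set /= row_mxKl row_mxKr.
  - by rewrite /prod_set /= row_mxKl row_mxKr.
  - by [].
  - rewrite !scale_row_mx add_row_mx -e -scalerDl addrC subrK scale1r.
    by rewrite hsubmxK.
  by move=> ex ey; split; [rewrite -ex|rewrite -ey]; rewrite row_mxKr.
by rewrite integer_points_prod.
Qed.

(** The direction space of the product is the direct sum of the images of [V] and [W] under the
    coordinate injections [f] and [g]. *)
Lemma has_dimension_prod M N (P : set 'rV[R]_M) (Q : set 'rV[R]_N) d e :
  has_dimension P d -> has_dimension Q e -> has_dimension (prod_set P Q) (d + e).
Proof.
move=> [x [V [dV hV]]] [y [W [dW hW]]].
pose f : 'Hom('rV[R]_M, 'rV[R]_(M + N)) := linfun (mulmxr (row_mx 1%:M 0)).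
pose g : 'Hom('rV[R]_N, 'rV[R]_(M + N)) := linfun (mulmxr (row_mx 0 1%:M)).
have fE u : f u = row_mx u 0 by rewrite lfunE /= mul_mx_row mulmx1 mulmx0.
have gE u : g u = row_mx 0 u by rewrite lfunE /= mul_mx_row mulmx1 mulmx0.
exists (row_mx x y), (f @: V + g @: W)%VS; split.
  rewrite dimv_disjoint_sum; last first.
    apply/eqP; rewrite -subv0; apply/subvP => z /memv_capP[].
    move=> /memv_imgP[u _ ->] /memv_imgP[w _]; rewrite fE gE => /eq_row_mx[-> _].
    by rewrite row_mx0 mem0v.
  rewrite !limg_dim_eq ?dV ?dW//; apply/eqP; rewrite -subv0; apply/subvP => z;
    move=> /memv_capP[_]; rewrite memv_ker ?fE ?gE => /eqP; rewrite -[RHS]row_mx0 => /eq_row_mx[].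
  - by move=> _ ->; rewrite mem0v.
  - by move=> ->; rewrite mem0v.
rewrite affine_hullE hull_prod -!affine_hullE hV hW; apply/seteqP; split.
  move=> z [[u Vu eu] [w Ww ew]]; exists (f u + g w).
    by rewrite /=; apply: memv_add; exact: memv_img.
  by rewrite fE gE !add_row_mx addr0 add0r eu ew hsubmxK.
move=> _ [_ /memv_addP[_ /memv_imgP[u Vu ->] [_ /memv_imgP[w Ww ->] ->]] <-].
rewrite fE gE !add_row_mx addr0 add0r.
by split; rewrite ?row_mxKl ?row_mxKr; [exists u|exists w].
Qed.

Lemma fset_set_infinite (T : choiceType) (A : set T) :
  infinite_set A -> fset_set A = fset0.
Proof. by rewrite /fset_set; case: pselect. Qed.

Lemma card_fset_set_seq (T : choiceType) (A : set T) (s : seq T) :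
  uniq s -> (forall x, A x <-> x \in s) -> #|` fset_set A| = size s.
Proof.
move=> us As; have -> : A = [set` [fset x in s]%fset].
  by apply/seteqP; split=> x /=; rewrite inE => /As.
by rewrite set_fsetK card_fseq undup_id.
Qed.

(** An infinite set counts as 0 here. If one factor is infinite, the product is either infinite or
    empty, according to the other factor, so both sides are 0. *)
Lemma card_prod_set M N (A : set 'rV[R]_M) (B : set 'rV[R]_N) :
  #|` fset_set (prod_set A B)| = (#|` fset_set A| * #|` fset_set B|)%N.
Proof.
have [fA|iA] := pselect (finite_set A); last first.
  rewrite (fset_set_infinite iA) cardfs0 mul0n.
  have [B0|/set0P[y By]] := eqVneq B set0.
    rewrite (_ : prod_set A B = set0) ?fset_set0 ?cardfs0//.
    by rewrite -subset0 B0 => z [].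
  rewrite fset_set_infinite ?cardfs0// => /(finite_image lsubmx) fAB; apply: iA.
  apply: sub_finite_set fAB => x Ax; exists (row_mx x y); last by rewrite row_mxKl.
  by rewrite /prod_set /= row_mxKl row_mxKr.
have [fB|iB] := pselect (finite_set B); last first.
  rewrite (fset_set_infinite iB) cardfs0 muln0.
  have [A0|/set0P[x Ax]] := eqVneq A set0.
    rewrite (_ : prod_set A B = set0) ?fset_set0 ?cardfs0//.
    by rewrite -subset0 A0 => z [].
  rewrite fset_set_infinite ?cardfs0// => /(finite_image rsubmx) fAB; apply: iB.
  apply: sub_finite_set fAB => y By; exists (row_mx x y); last by rewrite row_mxKr.
  by rewrite /prod_set /= row_mxKl row_mxKr.
rewrite (@card_fset_set_seq _ _ [seq row_mx x y | x <- fset_set A, y <- fset_set B]).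
- by rewrite size_allpairs.
- by apply: allpairs_uniq; rewrite ?fset_uniq// => -[x y] [x' y'] _ _ /= /eq_row_mx[-> ->].
move=> z; split=> [[Az Bz]|/allpairsP[[x y] /= [xA yB ->]]].
  apply/allpairsP; exists (lsubmx z, rsubmx z); rewrite /= hsubmxK.
  by rewrite !in_fset_set// !inE.
move: xA yB; rewrite !in_fset_set// !inE => xA yB.
by rewrite /prod_set /= row_mxKl row_mxKr.
Qed.

Lemma dilate_prod M N (A : set 'rV[R]_M) (B : set 'rV[R]_N) t :
  dilate t (prod_set A B) = prod_set (dilate t A) (dilate t B).
Proof.
apply/seteqP; split=> [_ [z [Az Bz] <-]|z [[x Ax ex] [y By ey]]].
  by split; rewrite linearZ; [exists (lsubmx z)|exists (rsubmx z)].
exists (row_mx x y); first by split; rewrite ?row_mxKl ?row_mxKr.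
by rewrite scale_row_mx ex ey hsubmxK.
Qed.

Lemma ehrhart_prod M N (P : set 'rV[R]_M) (Q : set 'rV[R]_N) t :
  ehrhart (prod_set P Q) t = (ehrhart P t * ehrhart Q t)%N.
Proof.
rewrite /ehrhart -card_prod_set dilate_prod integer_points_prod; congr #|` fset_set _|.
by apply/seteqP; split=> z; [case=> [[? ?] [? ?]]|case=> [[? ?] [? ?]]].
Qed.

End Products.

(** * Reeve's tetrahedron: vertices, dimension and Ehrhart polynomial *)

Section Tetrahedron.
Variable R : realType.

Lemma vertex_convex_hull N (S : set 'rV[R]_N) v : is_vertex (convex_hull S) v -> S v.
Proof.
rewrite convex_hullE => -[hv ext]; apply: contrapT => nSv.
(* Removing an extreme point from a convex set leaves it convex. *)
suff /(_ _ hv)[_]: hull (@unit_itv R) S `<=` hull (@unit_itv R) S `\ v by apply.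
apply: smallest_sub => [x y a a01 [hx xv] [hy yv]|x Sx]; last first.
  by split; [exact: sub_gen_smallest|move=> xv; apply: nSv; rewrite -xv].
split=> [|e]; first exact: hull_comb_closed.
have /andP[a0 a1] := a01.
have [a_0|a_neq0] := eqVneq a 0.
  by apply: yv; rewrite /= -e a_0 scale0r add0r subr0 scale1r.
have [a_1|a_neq1] := eqVneq a 1.
  by apply: xv; rewrite /= -e a_1 subrr scale0r addr0 scale1r.
have [||//] := ext x y a hx hy; last by [].
by rewrite !lt_neqAle a0 a1 eq_sym a_neq0 a_neq1.
Qed.

Lemma integral_polytope_hull N (S : set 'rV[R]_N) :
  finite_set S -> S `<=` @integer_points R N -> integral_polytope (convex_hull S).
Proof. by move=> fS IS; split=> [|v /vertex_convex_hull /IS//]; exists S. Qed.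

(* The cone {(s, s z) : s >= 0, z in A} is closed under addition. *)
Lemma convex_cone_add N (A : set 'rV[R]_N) (s t : R) x y :
  comb_closed (@unit_itv R) A -> 0 <= s -> 0 <= t -> A x -> A y ->
  exists2 z, A z & s *: x + t *: y = (s + t) *: z.
Proof.
move=> cA s0 t0 Ax Ay; have [st0|st_neq0] := eqVneq (s + t) 0.
  exists x => //; have [-> ->] : s = 0 /\ t = 0 by split; lra.
  by rewrite addr0 !scale0r addr0.
exists (s / (s + t) *: x + (1 - s / (s + t)) *: y).
  apply: cA => //; have st : 0 < s + t by rewrite lt_neqAle eq_sym st_neq0 addr_ge0.
  by rewrite /unit_itv /= divr_ge0 ?addr_ge0//= ler_pdivrMr// mul1r lerDl.
by rewrite scalerDr !scalerA; congr (_ *: _ + _ *: _); field.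
Qed.

Definition vec3 (a b c : R) : 'rV[R]_3 := \row_(j < 3) [:: a; b; c]`_j.

Lemma vec3_inj a b c a' b' c' :
  vec3 a b c = vec3 a' b' c' -> [/\ a = a', b = b' & c = c'].
Proof.
move=> /rowP e; have := (e 0, e 1, e (2 : 'I_3)).
by rewrite !mxE /= => -[[-> ->] ->].
Qed.

Lemma vec3P (x : 'rV[R]_3) : exists a b c, x = vec3 a b c.
Proof.
exists (x 0 0), (x 0 1), (x 0 2); apply/rowP => -[[|[|[|//]]] i3];
by rewrite !mxE /=; congr (x 0 _); exact: val_inj.
Qed.

Lemma scale_vec3 s a b c : s *: vec3 a b c = vec3 (s * a) (s * b) (s * c).
Proof. by apply/rowP => -[[|[|[|//]]] i3]; rewrite !mxE. Qed.

Lemma add_vec3 a b c a' b' c' :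
  vec3 a b c + vec3 a' b' c' = vec3 (a + a') (b + b') (c + c').
Proof. by apply/rowP => -[[|[|[|//]]] i3]; rewrite !mxE. Qed.

Lemma integer_points_vec3 a b c : integer_points (vec3 a b c) <->
  [/\ a \is a Num.int, b \is a Num.int & c \is a Num.int].
Proof.
split=> [/mxOverP e|[a_int b_int c_int]].
  by have := (e 0 0, e 0 1, e 0 2); rewrite !mxE /= => -[[-> ->] ->].
by apply/mxOverP => i -[[|[|[|//]]] i3]; rewrite mxE.
Qed.

(** The parameters [a], [b], [c] are the coefficients of e1, e2 and (1, 1, m), and the slack
    [s - a - b - c] is the weight of the origin. For s > 0 this is the [s]-th dilate of the
    tetrahedron. *)
Definition reeve (m s : R) : set 'rV[R]_3 := [set x | exists a b c : R,
  [/\ 0 <= a, 0 <= b, 0 <= c, a + b + c <= s & x = vec3 (a + c) (b + c) (m * c)]].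

Definition reeve_vertices (m s : R) : set 'rV[R]_3 :=
  [set vec3 0 0 0] `|` [set vec3 s 0 0] `|` [set vec3 0 s 0] `|` [set vec3 s s (m * s)].

(** The parameters depend linearly on the point, so the set is convex. Conversely, the four weights
    add up to [s]; the weighted vertices are added in pairs in the cone over the hull, and [s] is
    cancelled at the end. *)
Lemma reeveE m s : 0 < s -> reeve m s = convex_hull (reeve_vertices m s).
Proof.
move=> s0; rewrite convex_hullE; apply/seteqP; split; last first.
  apply: smallest_sub.
    move=> _ _ k /andP[k0 k1] [a [b [c [a0 b0 c0 abc ->]]]] [a' [b' [c' [a0' b0' c0' abc' ->]]]].
    exists (k * a + (1 - k) * a'), (k * b + (1 - k) * b'), (k * c + (1 - k) * c').
    split; try by rewrite addr_ge0// mulr_ge0// subr_ge0.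
      by nra.
    by rewrite !scale_vec3 add_vec3; congr vec3; ring.
  move=> x [[[->|->]|->]|->]; [exists 0, 0, 0|exists s, 0, 0|exists 0, s, 0|exists 0, 0, s];
    split; rewrite ?mulr0 ?addr0 ?add0r//; exact: ltW.
move=> _ [a [b [c [a0 b0 c0 abc ->]]]].
set H := hull _ _; have cH : comb_closed (@unit_itv R) H by exact: hull_comb_closed.
have sH : reeve_vertices m s `<=` H by exact: sub_gen_smallest.
have H0 : H (vec3 0 0 0) by apply: sH; do 3!left.
have H1 : H (vec3 s 0 0) by apply: sH; do 2!left; right.
have H2 : H (vec3 0 s 0) by apply: sH; left; right.
have H3 : H (vec3 s s (m * s)) by apply: sH; right.
have d0 : 0 <= s - a - b - c by lra.
have [x Hx ex] := convex_cone_add cH a0 b0 H1 H2.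
have [y Hy ey] := convex_cone_add cH c0 d0 H3 H0.
have [z Hz] := convex_cone_add cH (addr_ge0 a0 b0) (addr_ge0 c0 d0) Hx Hy.
have es : a + b + (c + (s - a - b - c)) = s by ring.
rewrite -ex -ey es.
rewrite !(scale_vec3, add_vec3) => ez; suff -> : vec3 (a + c) (b + c) (m * c) = z by [].
apply: (scalerI (lt0r_neq0 s0)); rewrite -ez scale_vec3; congr vec3; ring.
Qed.

Lemma integral_polytope_reeve (m k : nat) :
  (0 < k)%N -> integral_polytope (reeve m%:R k%:R).
Proof.
move=> k0; rewrite reeveE ?ltr0n//; apply: integral_polytope_hull.
  by rewrite !finite_setU.
move=> x [[[->|->]|->]|->]; apply/integer_points_vec3; split;
  by rewrite -?natrM ?rpred0 ?natr_int.
Qed.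

(** The affine hull contains 0, hence is closed under scaling, and doubling a midpoint gives closure
    under sums. It is thus a linear subspace, and it contains three independent edge vectors. *)
Lemma has_dimension_reeve m s : 0 < m -> 0 < s -> has_dimension (reeve m s) 3.
Proof.
move=> m0 s0; exists 0, fullv; split; first by rewrite dimvf /dim /= mul1n.
apply/seteqP; split=> [x _|_ [v _ <-]]; first by exists x; rewrite /= ?memvf ?add0r.
rewrite add0r affine_hullE; set H := hull _ _.
have cH : comb_closed setT H by exact: hull_comb_closed.
have sH : reeve m s `<=` H by exact: sub_gen_smallest.
have H0 : H 0.
  apply: sH; exists 0, 0, 0; rewrite mulr0 !addr0; split=> //; first exact: ltW.
  by rewrite -(scale0r (vec3 0 0 0)) scale_vec3 mul0r.
have HZ a x : H x -> H (a *: x).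
  by move=> Hx; rewrite -[_ *: x]addr0 -(scaler0 _ (1 - a)); exact: cH.
have HD x y : H x -> H y -> H (x + y).
  move=> Hx Hy; have := HZ 2 _ (cH x y (2^-1) I Hx Hy).
  have -> : 1 - 2^-1 = 2^-1 :> R by field.
  by rewrite -scalerDr scalerA divff ?scale1r.
have H1 : H (vec3 s 0 0).
  by apply: sH; exists s, 0, 0; rewrite ?mulr0 !addr0; split=> //; exact: ltW.
have H2 : H (vec3 0 s 0).
  by apply: sH; exists 0, s, 0; rewrite ?mulr0 !addr0 ?add0r; split=> //; exact: ltW.
have H3 : H (vec3 s s (m * s)).
  by apply: sH; exists 0, 0, s; rewrite ?addr0 !add0r; split=> //; exact: ltW.
have [a [b [c ->]]] := vec3P v.
(* The last coordinate determines the third coefficient; the first two then follow. *)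
have -> : vec3 a b c = ((a - c / m) / s) *: vec3 s 0 0 + (((b - c / m) / s) *: vec3 0 s 0
    + (c / m / s) *: vec3 s s (m * s)).
  by rewrite !(scale_vec3, add_vec3); congr vec3; field; rewrite ?gt_eqF.
by apply: (HD) => //; [exact: HZ|apply: HD; exact: HZ].
Qed.

Lemma dilate_reeve m s t : (0 < t)%N -> dilate t (reeve m s) = reeve m (t%:R * s).
Proof.
move=> t0; have tR : 0 < t%:R :> R by rewrite ltr0n.
apply/seteqP; split=> [_ [_ [a [b [c [a0 b0 c0 abc ->]]]] <-]|_ [a [b [c [a0 b0 c0 abc ->]]]]].
  exists (t%:R * a), (t%:R * b), (t%:R * c); split; rewrite ?pmulr_rge0//.
    by rewrite -!mulrDr ler_pM2l.
  by rewrite scale_vec3; congr vec3; ring.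
exists (t%:R^-1 *: vec3 (a + c) (b + c) (m * c)).
  exists (t%:R^-1 * a), (t%:R^-1 * b), (t%:R^-1 * c); split; rewrite ?pmulr_rge0 ?invr_gt0//.
    by rewrite -!mulrDr ler_pdivrMl.
  by rewrite scale_vec3; congr vec3; ring.
by rewrite scalerA divff ?scale1r ?gt_eqF.
Qed.

(** Inverting the parametrization gives c = Z/m, a = X - Z/m and b = Y - Z/m. Multiplying the
    conditions on a, b, c by [m] turns them into inequalities between natural numbers. *)
Lemma reeve_integer_points m n x : (0 < m)%N ->
  (reeve m%:R n%:R `&` @integer_points R 3) x <-> exists X Y Z : nat,
  [/\ x = vec3 X%:R Y%:R Z%:R, (Z <= m * X)%N, (Z <= m * Y)%N
    & (m * (X + Y) <= m * n + Z)%N].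
Proof.
move=> m0; have mR : 0 < m%:R :> R by rewrite ltr0n.
split=> [[[a [b [c [a0 b0 c0 abc ->]]]]]|[X [Y [Z [-> ZX ZY XY]]]]].
  have natP (u : R) : 0 <= u -> u \is a Num.int -> exists k : nat, u = k%:R.
    by move=> u0 ui; apply/natrP; rewrite natrEint ui u0.
  move=> /integer_points_vec3[/natP-/(_ (addr_ge0 a0 c0))[X eX]].
  move=> /natP-/(_ (addr_ge0 b0 c0))[Y eY] /natP-/(_ (mulr_ge0 (ler0n _ _) c0))[Z eZ].
  exists X, Y, Z; rewrite eX eY eZ; split=> //;
    rewrite -(ler_nat R) !(natrM, natrD) -?eX -?eY -?eZ; nra.
split; last by apply/integer_points_vec3; rewrite !natr_int.
move: ZX ZY XY; rewrite -!(ler_nat R) !(natrM, natrD) => ZX ZY XY.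
have mc : m%:R * (Z%:R / m%:R) = Z%:R :> R by field; rewrite gt_eqF.
exists (X%:R - Z%:R / m%:R), (Y%:R - Z%:R / m%:R), (Z%:R / m%:R); split.
- by rewrite -(ler_pM2l mR) mulr0 mulrBr mc subr_ge0.
- by rewrite -(ler_pM2l mR) mulr0 mulrBr mc subr_ge0.
- by rewrite divr_ge0.
- by rewrite -(ler_pM2l mR) !mulrDr !mulrN mc; lra.
- by congr vec3; [ring|ring|rewrite mc].
Qed.

Lemma ehrhart_reeve m k t : (0 < m)%N -> (0 < t)%N ->
  ehrhart (reeve m%:R k%:R : set 'rV[R]_3) t =
  ('C(t * k + 3, 3) + m.-1 * 'C(t * k + 1, 3))%N.
Proof.
move=> m0 t0; have [s [us ms ss]] := reeve_seq (t * k) m0.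
pose f (p : nat * nat * nat) := vec3 p.1.1%:R p.1.2%:R p.2%:R.
have f_inj : injective f.
  move=> [[x y] z] [[x' y'] z'] /vec3_inj[/= /eqP + /eqP + /eqP].
  by rewrite !eqr_nat => /eqP -> /eqP -> /eqP ->.
rewrite /ehrhart dilate_reeve// -natrM (@card_fset_set_seq _ _ (map f s)).
- by rewrite size_map.
- by rewrite map_inj_uniq.
move=> x; split=> [/(reeve_integer_points _ _ m0)[X [Y [Z [-> ZX ZY XY]]]]|/mapP[[[X Y] Z]]].
  by apply/mapP; exists (X, Y, Z); rewrite // ms ZX ZY XY.
rewrite ms => /and3P[ZX ZY XY] ->; apply/(reeve_integer_points _ _ m0).
by exists X, Y, Z.
Qed.

Lemma bin3_natr n : 'C(n, 3)%:R = (n%:R * (n%:R - 1) * (n%:R - 2)) / 6 :> R.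
Proof.
suff e : 'C(n, 3)%:R * 6 = n%:R * (n%:R - 1) * (n%:R - 2) :> R by rewrite -e mulfK.
have -> : 6 = (3`!)%:R :> R by [].
rewrite -natrM bin_ffact; case: n => [|[|[|n]]].
- by rewrite ffact_small//; ring.
- by rewrite ffact_small//; ring.
- by rewrite ffact_small//; ring.
by rewrite !ffactSS ffactn0 muln1 !natrM -!natr1; ring.
Qed.

Lemma ehrhart_polynomial_reeve m k : (0 < m)%N ->
  is_ehrhart_polynomial (reeve m%:R k%:R : set 'rV[R]_3)
   (1 + (k%:R * (2 - m%:R / 6)) *: 'X + (k%:R ^+ 2) *: 'X^2 + (k%:R ^+ 3 * (m%:R / 6)) *: 'X^3).
Proof.
move=> m0 t t0; rewrite ehrhart_reeve// natrD natrM !bin3_natr !(natrD, natrM) -subn1 natrB//.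
by rewrite !hornerE /=; field.
Qed.

End Tetrahedron.

(** * Sign and size estimates for coefficients *)

Lemma sgr_addl (R : realDomainType) (a b : R) : `|b| < `|a| -> Num.sg (a + b) = Num.sg a.
Proof.
case: (ltrgtP a 0) => [a0|a0|->]; last by rewrite normr0 normr_lt0.
  by rewrite (ltr0_norm a0) => h; rewrite !ltr0_sg//; move: h; rewrite ltr_norml; lra.
by rewrite (gtr0_norm a0) => h; rewrite !gtr0_sg//; move: h; rewrite ltr_norml; lra.
Qed.

(** Adding up all [|p_i|] and their inverses bounds both kinds at once; a zero coefficient has
    inverse 0 and adds nothing. *)
Lemma coef_bounds (R : realFieldType) (p : {poly R}) : p != 0 ->
  exists2 B : R, 1 <= B & forall i, `|p`_i| <= B /\ (p`_i != 0 -> 1 <= B * `|p`_i|).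
Proof.
move=> p0; pose F i := `|p`_i| + `|p`_i|^-1.
have F0 i : 0 <= F i by rewrite addr_ge0// invr_ge0.
have sF0 : 0 <= \sum_(j < size p) F j by apply: sumr_ge0 => j _.
exists (1 + \sum_(j < size p) F j) => [|i]; first by rewrite lerDl.
have [i_p|p_i] := ltnP i (size p); last first.
  by rewrite nth_default// normr0 eqxx addr_ge0.
have Fi : F i <= \sum_(j < size p) F j.
  by rewrite (bigD1 (Ordinal i_p))//= lerDl sumr_ge0.
have iV : 0 <= `|p`_i|^-1 by rewrite invr_ge0.
have iN : 0 <= `|p`_i| by [].
split=> [|pi0]; first by move: Fi; rewrite /F; lra.
rewrite -ler_pdivrMr ?normr_gt0// mul1r; move: Fi; rewrite /F; lra.
Qed.

Lemma coef_one_plus_sum (R : nzRingType) (n : nat) (u : nat -> R) i :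
  (1 + \sum_(1 <= j < n.+1) u j *: 'X^j)`_i =
  if i == 0%N then 1 else if (i <= n)%N then u i else 0.
Proof.
have -> : 1 + \sum_(1 <= j < n.+1) u j *: 'X^j =
    \poly_(j < n.+1) (if j == 0%N then 1 else u j).
  rewrite poly_def -(big_mkord xpredT (fun j => (if j == 0%N then 1 else u j) *: 'X^j)).
  rewrite big_nat_recl// scale1r expr0; congr (_ + _); rewrite big_add1 /=.
  by apply: eq_bigr.
by rewrite coef_poly ltnS; case: i.
Qed.

(** The cubic contribution stands first because it is the one that will dominate. The tests replace
    truncated indices by the coefficient 0. *)
Lemma coef_mul_cubic (R : comNzRingType) (p : {poly R}) (a b c : R) i :
  (p * (1 + a *: 'X + b *: 'X^2 + c *: 'X^3))`_i =
  c * (if (i < 3)%N then 0 else p`_(i - 3)) + (b * (if (i < 2)%N then 0 else p`_(i - 2))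
    + a * (if i == 0%N then 0 else p`_i.-1) + p`_i).
Proof.
rewrite !mulrDr mulr1 -!scalerAr !coefD !coefZ coefMX !coefMXn.
by rewrite addrC; congr (_ + _); rewrite -addrA [LHS]addrC [X in X + _]addrC.
Qed.

(** B |r| <= S B^2 <= k S < a <= a B |e|; divide by B. Here [S] bounds the total weight of the other
    coefficients. *)
Lemma dominant_term (R : realFieldType) (B e k S a r : R) : 0 < B -> B ^+ 2 <= k ->
  0 <= S -> k * S < a -> 1 <= B * `|e| -> `|r| <= S * B -> `|r| < `|a * e|.
Proof.
move=> B0 Bk S0 kSa Be rS; apply: (le_lt_trans rS); rewrite -(ltr_pM2r B0).
have BS : B ^+ 2 * S <= k * S by rewrite ler_wpM2r.
have a0 : 0 < a.
  by apply: le_lt_trans kSa; rewrite mulr_ge0//; apply: le_trans Bk; exact: sqr_ge0.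
rewrite normrM (gtr0_norm a0) -mulrA [_ * B]mulrC.
have := ler_wpM2l (ltW a0) Be; nra.
Qed.

Lemma ler_norm_comb3 (R : realDomainType) (B a b x y z : R) : 0 <= a -> 0 <= b ->
  `|x| <= B -> `|y| <= B -> `|z| <= B -> `|a * x - b * y + z| <= (a + b + 1) * B.
Proof.
move=> a0 b0 xB yB zB; rewrite !mulrDl mul1r.
apply: (le_trans (ler_normD _ _)); apply: lerD => //.
apply: (le_trans (ler_normB _ _)).
by rewrite !normrM (ger0_norm a0) (ger0_norm b0) lerD// ler_wpM2l.
Qed.

(** With [K] for k, the cubic factor is 1 - a1 X + a2 X^2 + a3 X^3. The last two bounds are the
    hypothesis [k * S < a] of [dominant_term], for i >= 3 and for i = 2, where [a1] itself is the
    dominant multiplier. *)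
Lemma cubic_coef_growth (R : realFieldType) (K : R) : 2 <= K ->
  let a1 := K * (K ^+ 2 + 2) in
  let a2 := K ^+ 2 in
  let a3 := K ^+ 3 * (K ^+ 2 + 4) in
  [/\ 0 < a1, 0 <= a2, 0 < a3, K * (a2 + a1 + 1) < a3 & K * (a2 + 0 + 1) < a1].
Proof.
move=> K2 a1 a2 a3; have K0 : 0 < K by lra.
have a2_ge0 : 0 <= a2 by rewrite exprn_ge0// ltW.
split=> //; first by rewrite mulr_gt0// ltr_wpDl.
- by rewrite mulr_gt0 ?exprn_gt0// ltr_wpDl.
(* Splits off the right-hand side; the remaining terms are positive, as 3 K^2 - 2 K - 1 = (3 K +
   1)(K - 1). *)
- have -> : a3 = K * (K ^+ 3 * (K - 1) + (3 * K ^+ 2 - 2 * K - 1) + (a2 + a1 + 1)).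
    by rewrite /a1 /a2 /a3; ring.
  rewrite ltr_pM2l// ltrDr ltr_wpDl//; last by nra.
  by rewrite mulr_ge0 ?exprn_ge0 ?subr_ge0//; lra.
- by rewrite ltr_pM2l// /a2; lra.
Qed.

(** * Choice of the parameters and signs of the product coefficients *)

Theorem theorem6p5 (R : realType) (N d : nat) (P : set 'rV[R]_N) (c : nat -> R)
    (d_ge3 : (3 <= d)%N)
    (P_integral : integral_polytope P)
    (P_dim : has_dimension P d)
    (P_ehrhart : is_ehrhart_polynomial P (1 + \sum_(1 <= i < d.+1) c i *: 'X^i))
    (c_neq0 : forall i : nat, (1 <= i <= d)%N -> c i != 0) :
  exists (M : nat) (Q : set 'rV[R]_M) (h : nat -> R),
    [/\ integral_polytope Q,
        has_dimension Q (d + 3)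
      & is_ehrhart_polynomial Q (1 + \sum_(1 <= i < (d + 3).+1) h i *: 'X^i)] /\
    [/\ forall i : nat, (4 <= i <= d + 1)%N -> Num.sg (h i) = Num.sg (c (i - 3)%N),
        Num.sg (h 3%N) = 1,
        Num.sg (h 2%N) = - Num.sg (c 1%N)
      & Num.sg (h 1%N) = -1].
Proof.
set p : {poly R} := (X in is_ehrhart_polynomial P X) in P_ehrhart.
have pE i : p`_i = if i == 0%N then 1 else if (i <= d)%N then c i else 0.
  exact: coef_one_plus_sum.
clearbody p; have p0 : p`_0 = 1 by rewrite pE.
have pc i : (1 <= i <= d)%N -> p`_i = c i by rewrite pE; case: i => //= i ->.
have p_gtd i : (d < i)%N -> p`_i = 0 by rewrite pE; case: i => //= i; rewrite ltnNge => /negbTE ->.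
have p_neq0 i : (i <= d)%N -> p`_i != 0.
  by case: i => [_|i id]; [rewrite p0 oner_neq0|rewrite pc ?c_neq0].
have [|B B1 pB] := @coef_bounds R p.
  by apply/eqP => e; have := p_neq0 0%N isT; rewrite e coef0 eqxx.
have B0 : 0 < B by lra.
(* [B ^+ 2 <= k] is for [dominant_term], [2 <= k] for [cubic_coef_growth]. *)
have [k [k2 Bk]] : exists k : nat, (2 <= k)%N /\ B ^+ 2 <= k%:R.
  have [k Bk] : exists k : nat, B ^+ 2 < k%:R.
    by exists (Num.bound (B ^+ 2)); apply: archi_boundP; exact: sqr_ge0.
  by exists (k + 2)%N; rewrite natrD; split; [lia|lra].
pose m := (6 * (k ^ 2 + 4))%N; have m0 : (0 < m)%N by rewrite /m; lia.
have k0 : (0 < k)%N by lia.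
set K : R := k%:R in Bk.
have K2 : 2 <= K by rewrite (ler_nat _ 2).
pose a1 : R := K * (K ^+ 2 + 2); pose a2 : R := K ^+ 2; pose a3 : R := K ^+ 3 * (K ^+ 2 + 4).
have q_ehrhart := @ehrhart_polynomial_reeve R m k m0.
set q := (X in is_ehrhart_polynomial _ X) in q_ehrhart.
have mE : m%:R / 6 = K ^+ 2 + 4 :> R by rewrite /m natrM natrD natrX; field.
have qE : q = 1 - a1 *: 'X + a2 *: 'X^2 + a3 *: 'X^3.
  rewrite /q mE -/K -scaleNr; congr (_ + _ *: _ + _ + _); rewrite /a1; ring.
exists (N + 3)%N, (prod_set P (reeve m%:R K)), (fun i => (p * q)`_i).
have hE i : (p * q)`_i = a3 * (if (i < 3)%N then 0 else p`_(i - 3))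
    + (a2 * (if (i < 2)%N then 0 else p`_(i - 2))
      + (- a1) * (if i == 0%N then 0 else p`_i.-1) + p`_i).
  by rewrite qE -scaleNr coef_mul_cubic.
split.
  split; first exact/integral_polytope_prod/integral_polytope_reeve.
    by apply: has_dimension_prod => //; apply: has_dimension_reeve; rewrite ltr0n.
  move=> t t0; rewrite ehrhart_prod natrM P_ehrhart// q_ehrhart// -hornerM.
  congr horner; apply/polyP => i; rewrite coef_one_plus_sum.
  case: ifP => [/eqP ->|i0]; first by rewrite hE p0 /=; ring.
  (* Above degree d + 3 all four shifted indices exceed d, so every term vanishes. *)
  case: leqP => // id; rewrite hE i0 !p_gtd; [|lia..].
  by rewrite !if_same; ring.
have growth := cubic_coef_growth K2; rewrite -/a1 -/a2 -/a3 in growth.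
(* The case i = 3 is included: there the comparison is with the constant term 1, which gives the
   sign of h_3. *)
have sg_big i : (3 <= i <= d + 3)%N -> Num.sg ((p * q)`_i) = Num.sg (p`_(i - 3)).
  move=> /andP[i3 id]; rewrite hE; set r := (X in _ + X).
  have rE : r = a2 * p`_(i - 2) - a1 * p`_i.-1 + p`_i.
    by rewrite /r !ifF ?mulNr//; lia.
  have [_] := pB (i - 3)%N => /(_ (p_neq0 _ _)) pi3.
  have {}pi3 : 1 <= B * `|p`_(i - 3)| by apply: pi3; lia.
  have [a1_gt0 a2_ge0 a3_gt0 a3_large _] := growth.
  rewrite ltnNge i3 /= sgr_addl; first by rewrite sgrM gtr0_sg ?mul1r.
  apply: (@dominant_term _ B _ K (a2 + a1 + 1)) => //; first by lra.
  rewrite rE; apply: (ler_norm_comb3 a2_ge0 (ltW a1_gt0)).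
  - by case: (pB (i - 2)%N).
  - by case: (pB i.-1).
  - by case: (pB i).
have c1 : p`_1 = c 1%N by rewrite pc//; lia.
have Bc1 : 1 <= B * `|c 1%N|.
  by rewrite -c1; have [_] := pB 1%N; apply; apply: p_neq0; lia.
split.
- by move=> i /andP[i4 id]; rewrite sg_big ?pc//; lia.
- by rewrite sg_big ?p0 ?sgr1//; lia.
- have [a1_gt0 a2_ge0 _ _ a1_large] := growth.
  (* The term [0 * 0] gives the remainder the shape of [ler_norm_comb3], with total weight
     [a2 + 0 + 1]. *)
  have -> : (p * q)`_2 = - a1 * c 1%N + (a2 * 1 - 0 * 0 + p`_2).
    by rewrite hE /= p0 c1; ring.
  rewrite sgr_addl; first by rewrite mulNr sgrN sgrM gtr0_sg ?mul1r.
  rewrite mulNr normrN; apply: (@dominant_term _ B _ K (a2 + 0 + 1)) => //.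
  + by rewrite addr0 addr_ge0.
  + apply: ler_norm_comb3; rewrite ?normr1 ?normr0//; first exact: ltW.
    by case: (pB 2%N).
(* Here h_1 = c_1 - a1, and c_1 <= B <= B^2 <= K < a1. *)
- have [_ a2_ge0 _ _ a1_large] := growth.
  rewrite hE /= p0 c1 ltr0_sg//; have [+ _] := pB 1%N; rewrite c1.
  rewrite ler_norml => /andP[_ cB]; rewrite !mulr0 mulr1 !add0r; nra.
Qed.
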